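(* Let $d\ge 1$ and let $F\colon\Omega\to\Omega$ be a piecewise translation in $\mathbb{R}^d$ with $m=d+1$ branches, with translation vectors $v_0,\dots,v_d$ such that $v_1-v_0,\dots,v_d-v_0$ are linearly independent over $\mathbb{R}$. If the torus rotation $R\colon\mathbb{T}\to\mathbb{T}$ is ergodic (with respect to Haar measure), then $F$ is finite type, i.e. there is $n\in\mathbb{N}$ with $\Omega_n=\Omega_{n+1}$ (and hence $\Omega_k=A$ for all $k\ge n$).
   Context: A region is a compact subset of $\mathbb{R}^d$ which equals the closure of its interior. A piecewise translation with $m$ branches is defined as follows: $\Omega\subset\mathbb{R}^d$ is a region, $\Omega=P_0\cup\dots\cup P_{m-1}$ where each $P_i$ is a region, distinct $P_i$ intersect only in their boundaries, and $\mathrm{Leb}(\partial P_i)=0$ for all $i$. Vectors $v_0,\dots,v_{m-1}\in\mathbb{R}^d$ satisfy $x+v_i\in\Omega$ for all $x\in P_i$. For $x\in\Omega$, $i(x)$ denotes an index with $x\in P_{i(x)}$, the ambiguity on overlapping boundaries being resolved by a fixed rule so that $i$ is measurable; $v(x)=v_{i(x)}$ and $F(x)=x+v(x)$. Set $\Omega_0=\Omega$ and $\Omega_n=\overline{F(\Omega_{n-1})}$ for $n\ge1$; the attractor is $A=\bigcap_{n\ge0}\Omega_n$. $F$ is finite type if $\Omega_n=\Omega_{n+1}$ for some $n$. When $m=d+1$ and $v_1-v_0,\dots,v_d-v_0$ are linearly independent, $\mathcal{L}$ denotes the lattice generated by $v_1-v_0,\dots,v_d-v_0$, $\mathbb{T}=\mathbb{R}^d/\mathcal{L}$,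 $\pi\colon\mathbb{R}^d\to\mathbb{T}$ the canonical projection, and $R\colon\mathbb{T}\to\mathbb{T}$, $R(\phi)=\phi+\pi(v_0)$; then $R\circ\pi=\pi\circ F$. *)

(* Defs.v *)
From Stdlib Require Import Reals ZArith.
From mathcomp Require Import all_boot.
Set Implicit Arguments. Unset Strict Implicit. Unset Printing Implicit Defensive.
Open Scope R_scope.

Definition vec (d : nat) := 'I_d -> R.
Definition vset (d : nat) := vec d -> Prop.

Definition vadd {d} (x y : vec d) : vec d := fun k => x k + y k.
Definition vsub {d} (x y : vec d) : vec d := fun k => x k - y k.
Definition vzero {d} : vec d := fun _ => 0.
Definition vsum {d n} (f : 'I_n -> vec d) : vec d :=
  fun k => \big[Rplus/0]_(i < n) f i k.

(* sup-norm ball (induces the usual topology of R^d) *)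
Definition ball {d} (x : vec d) (r : R) : vset d :=
  fun y => forall k, Rabs (y k - x k) < r.

Definition vopen {d} (S : vset d) : Prop :=
  forall x, S x -> exists r, 0 < r /\ forall y, ball x r y -> S y.
Definition interior {d} (S : vset d) : vset d :=
  fun x => exists r, 0 < r /\ forall y, ball x r y -> S y.
Definition closure {d} (S : vset d) : vset d :=
  fun x => forall r, 0 < r -> exists y, ball x r y /\ S y.
Definition boundary {d} (S : vset d) : vset d :=
  fun x => closure S x /\ ~ interior S x.

Definition compact {d} (S : vset d) : Prop :=
  forall (I : Type) (U : I -> vset d),
    (forall i, vopen (U i)) ->
    (forall x, S x -> exists i, U i x) ->
    exists l : list I, forall x, S x -> exists i, List.In i l /\ U i x.

Definition set_eq {d} (S T : vset d) : Prop := forall x, S x <-> T x.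

Definition region {d} (S : vset d) : Prop :=
  compact S /\ set_eq S (closure (interior S)).

Definition box_vol {d} (a b : vec d) : R :=
  \big[Rmult/1]_(k < d) Rmax 0 (b k - a k).
Definition in_box {d} (a b : vec d) (x : vec d) : Prop :=
  forall k, a k <= x k <= b k.
Definition outer_le {d} (S : vset d) (r : R) : Prop :=
  exists a b : nat -> vec d,
    (forall x, S x -> exists n, in_box (a n) (b n) x) /\
    (forall N, sum_f_R0 (fun n => box_vol (a n) (b n)) N <= r).
Definition null {d} (S : vset d) : Prop := forall eps, 0 < eps -> outer_le S eps.
Definition measurable {d} (E : vset d) : Prop :=
  forall eps, 0 < eps ->
    exists G : vset d, vopen G /\ (forall x, E x -> G x) /\
                       outer_le (fun x => G x /\ ~ E x) eps.

Definition lin_indep {d n} (w : 'I_n -> vec d) : Prop :=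
  forall c : 'I_n -> R,
    vsum (fun i => fun k => c i * w i k) = vzero -> forall i, c i = 0.

Definition in_lattice {d n} (w : 'I_n -> vec d) (l : vec d) : Prop :=
  exists c : 'I_n -> Z, l = vsum (fun i => fun k => IZR (c i) * w i k).

Definition diffs {d} (v : 'I_d.+1 -> vec d) : 'I_d -> vec d :=
  fun i => vsub (v (lift ord0 i)) (v ord0).

(* Ergodicity of the rotation R(phi) = phi + pi(v0) on T = R^d / L w.r.t.
   Haar measure, stated through the lift to R^d: measurable subsets B of T
   correspond to L-periodic Lebesgue measurable subsets E = pi^{-1}(B) of R^d;
   R^{-1}B = B iff E is invariant under x |-> x + v0; Haar(B) = 0 iff E is
   Lebesgue-null, Haar(B) = 1 iff the complement of E is Lebesgue-null. *)
Definition rotation_ergodic {d} (v : 'I_d.+1 -> vec d) : Prop :=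
  forall E : vset d,
    measurable E ->
    (forall x l, in_lattice (diffs v) l -> (E x <-> E (vadd x l))) ->
    (forall x, E x <-> E (vadd x (v ord0))) ->
    null E \/ null (fun x => ~ E x).

Definition piecewise_translation {d m} (Om : vset d) (P : 'I_m -> vset d)
    (v : 'I_m -> vec d) (ix : vec d -> 'I_m) : Prop :=
  region Om /\
  set_eq Om (fun x => exists i, P i x) /\
  (forall i, region (P i)) /\
  (forall i j x, i <> j -> P i x -> P j x -> boundary (P i) x /\ boundary (P j) x) /\
  (forall i, null (boundary (P i))) /\
  (forall i x, P i x -> Om (vadd x (v i))) /\
  (forall x, Om x -> P (ix x) x) /\
  (forall i, measurable (fun x => Om x /\ ix x = i)).

Definition pt_map {d m} (v : 'I_m -> vec d) (ix : vec d -> 'I_m) (x : vec d) : vec d :=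
  vadd x (v (ix x)).

Definition image {d} (f : vec d -> vec d) (S : vset d) : vset d :=
  fun y => exists x, S x /\ y = f x.

Fixpoint Omega_n {d m} (Om : vset d) (v : 'I_m -> vec d) (ix : vec d -> 'I_m)
    (n : nat) : vset d :=
  match n with
  | O => Om
  | S n' => closure (image (pt_map v ix) (Omega_n Om v ix n'))
  end.

Definition attractor {d m} (Om : vset d) (v : 'I_m -> vec d) (ix : vec d -> 'I_m) : vset d :=
  fun x => forall n, Omega_n Om v ix n x.

(* Main.v *)
(* Let L be the lattice spanned by the differences of the translation vectors.
   The number of points of Omega_n in a coset x + L is finite, decreases with n
   and is upper semicontinuous in x. At a pair (n, x0) where it is minimal,
   Omega_n and the attractor A therefore agree on U + L for some ball U around
   x0. As F is the translation by v_0 modulo L, A is closed and F(A) is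
   contained in A, Omega_(n+j) and A then agree on U + L + j v_0 for all j >= 0.
   Ergodicity makes L + Z v_0 dense, because a neighbourhood of this group is
   an invariant open set and nonempty open sets are not null; by compactness
   finitely many of the sets U + L + j v_0 cover Omega. *)
Require Import Defs.
From Stdlib Require Import Reals ZArith Lra Lia Classical ClassicalChoice FunctionalExtensionality.
From mathcomp Require Import all_boot ssralg matrix mxalgebra Rstruct.
(* [fingraph] exports another [closure]. *)
Import Defs.
Open Scope R_scope.

(** * Common radii and ranks over finite families *)

Lemma list_exists_min_radius {I : Type} (Q : I -> R -> Prop) (l : list I) :
  (forall i r r', r' <= r -> Q i r -> Q i r') ->
  (forall i, List.In i l -> exists r, 0 < r /\ Q i r) ->
  exists r, 0 < r /\ forall i, List.In i l -> Q i r.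
Proof.
move=> mono; elim: l => [|i l IH] H; first by exists 1; split; [lra|].
have [r [r0 Hr]] := IH (fun j jl => H j (or_intror jl)).
have [s [s0 Hs]] := H i (or_introl erefl).
exists (Rmin r s); split; first exact: Rmin_pos.
move=> j [<-|jl].
- exact: mono (Rmin_r _ _) Hs.
- exact: mono (Rmin_l _ _) (Hr j jl).
Qed.

Lemma list_exists_max_rank {I : Type} (Q : I -> nat -> Prop) (l : list I) :
  (forall i n n', (n <= n')%N -> Q i n -> Q i n') ->
  (forall i, List.In i l -> exists n, Q i n) ->
  exists n, forall i, List.In i l -> Q i n.
Proof.
move=> mono; elim: l => [|i l IH] H; first by exists 0%N.
have [r Hr] := IH (fun j jl => H j (or_intror jl)).
have [s Hs] := H i (or_introl erefl).
exists (maxn r s) => j [<-|jl].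
- exact: mono (leq_maxr _ _) Hs.
- exact: mono (leq_maxl _ _) (Hr j jl).
Qed.

Lemma In_enum (T : finType) (x : T) : List.In x (enum T).
Proof.
have: x \in enum T by rewrite mem_enum.
elim: (enum T) => // y s IH; rewrite inE => /orP[/eqP ->|/IH]; by [left|right].
Qed.

Lemma fin_exists_min_radius {I : finType} (Q : I -> R -> Prop) :
  (forall i r r', r' <= r -> Q i r -> Q i r') ->
  (forall i, exists r, 0 < r /\ Q i r) ->
  exists r, 0 < r /\ forall i, Q i r.
Proof.
move=> mono H.
have [r [r0 Hr]] := @list_exists_min_radius I Q (enum I) mono (fun i _ => H i).
by exists r; split=> // i; apply/Hr/In_enum.
Qed.

Lemma fin_exists_max_rank {I : finType} (Q : I -> nat -> Prop) :
  (forall i n n', (n <= n')%N -> Q i n -> Q i n') ->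
  (forall i, exists n, Q i n) -> exists n, forall i, Q i n.
Proof.
move=> mono H.
have [n Hn] := @list_exists_max_rank I Q (enum I) mono (fun i _ => H i).
by exists n => i; apply/Hn/In_enum.
Qed.

Lemma exists_INR_gt (x : R) : exists n : nat, x < INR n.
Proof.
have [Hu _] := archimed x; exists (Z.to_nat (up x)).
rewrite INR_IZR_INZ; apply: Rlt_le_trans Hu _.
by apply: IZR_le; lia.
Qed.

(** * Volumes of boxes *)

Lemma box_vol_ge0 {d} (a b : vec d) : 0 <= box_vol a b.
Proof.
rewrite /box_vol; apply: (big_ind (fun x => 0 <= x)); [lra|..].
- exact: Rmult_le_pos.
- move=> k _; exact: Rmax_l.
Qed.

Lemma box_vol_le {d} (a b a' b' : vec d) :
  (forall k, a' k <= a k) -> (forall k, b k <= b' k) ->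
  box_vol a b <= box_vol a' b'.
Proof.
move=> Ha Hb; suff: 0 <= box_vol a b <= box_vol a' b' by case.
rewrite /box_vol; apply: (big_ind2 (fun x y => 0 <= x <= y)); [lra|..].
- move=> x1 x2 y1 y2 [? ?] [? ?]; split; first exact: Rmult_le_pos.
  exact: Rmult_le_compat.
- move=> k _; split; first exact: Rmax_l.
  apply: Rle_max_compat_l; move: (Ha k) (Hb k); lra.
Qed.

Lemma box_vol_gt0 {d} (a b : vec d) : (forall k, a k < b k) -> 0 < box_vol a b.
Proof.
move=> H; rewrite /box_vol; apply: (big_ind (fun x => 0 < x)); [lra|..].
- exact: Rmult_lt_0_compat.
- move=> k _; apply: Rlt_le_trans (Rmax_r _ _); move: (H k); lra.
Qed.

Lemma box_volD1 {d} (k : 'I_d) (a b : vec d) :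
  box_vol a b = Rmax 0 (b k - a k) * \big[Rmult/1]_(j < d | j != k) Rmax 0 (b j - a j).
Proof. by rewrite /box_vol (bigD1 k). Qed.

(** * Cutting boxes along coordinate hyperplanes *)

Definition update {d} (x : vec d) (k : 'I_d) (t : R) : vec d :=
  fun j => if j == k then t else x j.

Lemma updateE {d} (x : vec d) (k : 'I_d) (t : R) : update x k t k = t.
Proof. by rewrite /update eqxx. Qed.

Lemma update_neq {d} (x : vec d) (k j : 'I_d) (t : R) :
  j != k -> update x k t j = x j.
Proof. by rewrite /update => /negbTE ->. Qed.

(** [capl a lo] and [capr b hi] are the corners of the intersection of two boxes. If the
    intersection is empty, they are in the wrong order in some coordinate, and the [Rmax 0] in
    [box_vol] makes the volume 0. *)
Definition capl {d} (a lo : vec d) : vec d := fun k => Rmax (a k) (lo k).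
Definition capr {d} (b hi : vec d) : vec d := fun k => Rmin (b k) (hi k).

Lemma cap_length_split (a b lo m hi : R) : lo <= m <= hi ->
  Rmax 0 (Rmin b hi - Rmax a lo) =
  Rmax 0 (Rmin b m - Rmax a lo) + Rmax 0 (Rmin b hi - Rmax a m).
Proof.
move=> Hm; rewrite /Rmax /Rmin.
case: (Rle_dec b hi) => ?; case: (Rle_dec b m) => ?; case: (Rle_dec a lo) => ?;
  case: (Rle_dec a m) => ?;
  repeat match goal with |- context [Rle_dec ?x ?y] => destruct (Rle_dec x y) end; lra.
Qed.

Lemma box_vol_cap_split {d} (a b lo hi : vec d) (k : 'I_d) (m : R) :
  lo k <= m <= hi k ->
  box_vol (capl a lo) (capr b hi) =
  box_vol (capl a lo) (capr b (update hi k m)) +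
  box_vol (capl a (update lo k m)) (capr b hi).
Proof.
move=> Hm; rewrite !(box_volD1 k) /capl /capr !updateE (cap_length_split _ _ _ _ _ Hm) Rmult_plus_distr_r.
by congr (_ * _ + _ * _); apply: eq_bigr => j jk; rewrite update_neq.
Qed.

Lemma box_vol_mid {d} (lo hi : vec d) (k : 'I_d) (m := (lo k + hi k) / 2) :
  box_vol lo (update hi k m) = box_vol lo hi / 2 /\
  box_vol (update lo k m) hi = box_vol lo hi / 2.
Proof.
have half x : Rmax 0 (x / 2) = Rmax 0 x / 2.
  by rewrite /Rmax; case: Rle_dec => ?; case: Rle_dec => ?; lra.
rewrite !(box_volD1 k) !updateE.
have -> : m - lo k = (hi k - lo k) / 2 by rewrite /m; lra.
have -> : hi k - m = (hi k - lo k) / 2 by rewrite /m; lra.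
rewrite half.
split; rewrite /Rdiv (Rmult_comm _ (/ 2)) Rmult_assoc Rmult_comm;
  by congr (_ * _ * _); apply: eq_bigr => j jk; rewrite update_neq.
Qed.

Lemma le_sum_f_R0 (u : nat -> R) (n : nat) :
  (forall i, 0 <= u i) -> u n <= sum_f_R0 u n.
Proof.
move=> u0; case: n => [|n] /=; first lra.
by move: (cond_pos_sum u n u0); lra.
Qed.

Lemma sum_f_R0_mono (u : nat -> R) (n m : nat) :
  (forall i, 0 <= u i) -> (n <= m)%N -> sum_f_R0 u n <= sum_f_R0 u m.
Proof.
move=> u0; elim: m => [|m IH]; first by rewrite leqn0 => /eqP ->; lra.
rewrite leq_eqVlt ltnS => /orP[/eqP ->|/IH /=]; first lra.
by move: (u0 m.+1); lra.
Qed.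

(** The boxes fill at most half of the given one, counted with multiplicity. Any ratio below 1 would
    be contradicted by a box containing all of a nondegenerate one. *)
Definition sparse_in {d} (a b : nat -> vec d) (lo hi : vec d) : Prop :=
  forall N, sum_f_R0 (fun n => box_vol (capl (a n) lo) (capr (b n) hi)) N
            <= box_vol lo hi / 2.

(** Averaging: if both halves violate the bound, at ranks [N1] and [N2], then at the larger rank
    each sum exceeds a quarter of the whole volume, so together they exceed half of it. *)
Lemma sparse_in_half {d} (a b : nat -> vec d) (lo hi : vec d) (k : 'I_d)
    (m := (lo k + hi k) / 2) :
  lo k <= hi k -> sparse_in a b lo hi ->
  sparse_in a b lo (update hi k m) \/ sparse_in a b (update lo k m) hi.
Proof.
move=> le_lohi H; apply: NNPP => /not_or_and [].
move=> /not_all_ex_not [N1 /Rnot_le_lt H1] /not_all_ex_not [N2 /Rnot_le_lt H2].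
have [E1 E2] := box_vol_mid lo hi k.
rewrite E1 in H1; rewrite E2 in H2.
move: (H (maxn N1 N2)).
have mid : lo k <= m <= hi k by rewrite /m; lra.
rewrite (PartSum.sum_eq _ _ _ (fun n _ => box_vol_cap_split (a n) (b n) _ _ _ _ mid)) sum_plus.
have le1 := @sum_f_R0_mono _ N1 (maxn N1 N2)
  (fun n => box_vol_ge0 (capl (a n) lo) (capr (b n) (update hi k m))) (leq_maxl _ _).
have le2 := @sum_f_R0_mono _ N2 (maxn N1 N2)
  (fun n => box_vol_ge0 (capl (a n) (update lo k m)) (capr (b n) hi)) (leq_maxr _ _).
rewrite -/m in H1 H2.
lra.
Qed.

Lemma sparse_in_halves {d} (a b : nat -> vec d) (lo hi : vec d) :
  (forall k, lo k <= hi k) -> sparse_in a b lo hi ->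
  exists q : vec d * vec d, sparse_in a b q.1 q.2 /\
    forall k, [/\ lo k <= q.1 k, q.2 k <= hi k & q.2 k - q.1 k = (hi k - lo k) / 2].
Proof.
move=> le_lohi H.
(* Sides are halved one coordinate at a time; [i] counts those already halved. *)
suff /(_ d (leqnn d)) [q [Hq Hk]] : forall i, (i <= d)%N ->
    exists q : vec d * vec d, sparse_in a b q.1 q.2 /\
      forall k, [/\ lo k <= q.1 k, q.2 k <= hi k &
        q.2 k - q.1 k = if (k < i)%N then (hi k - lo k) / 2 else hi k - lo k].
  by exists q; split=> // k; case: (Hk k) => ? ?; rewrite ltn_ord.
elim=> [|i IH] id.
  exists (lo, hi); split=> //= k; split; by [apply: Rle_refl|].
have [[lo' hi'] /= [Hs Hk]] := IH (ltnW id).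
pose k0 := Ordinal id; pose m := (lo' k0 + hi' k0) / 2.
have [L1 L2] := Hk k0; rewrite ltnn => L3.
have le0 := le_lohi k0.
have Hlt j : j != k0 -> (j < i.+1)%N = (j < i)%N.
  by move=> jk; rewrite ltnS leq_eqVlt -[X in (_ == X)]/(val k0) (inj_eq val_inj) (negbTE jk).
have [S|S] := @sparse_in_half d a b lo' hi' k0 ltac:(lra) Hs;
  [exists (lo', update hi' k0 m)|exists (update lo' k0 m, hi')];
  (split; first by []) => k /=; have [-> |kk0] := eqVneq k k0;
  rewrite ?updateE ?update_neq ?ltnSn ?Hlt //; split; rewrite /m; lra.
Qed.

(* Bisection: were the total volume at most half of that of the box, the same
   would hold in arbitrarily small subboxes, but one of the covering boxes
   contains a whole neighbourhood of the point they shrink to. *)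
Lemma open_boxes_not_sparse {d} (a b : nat -> vec d) (lo hi : vec d) :
  (forall k, lo k < hi k) ->
  (forall x, in_box lo hi x -> exists n, forall k, a n k < x k < b n k) ->
  ~ sparse_in a b lo hi.
Proof.
move=> lt_lohi cover Hs.
pose good (q : vec d * vec d) := (forall k, q.1 k <= q.2 k) /\ sparse_in a b q.1 q.2.
pose step (q q' : vec d * vec d) := forall k,
  [/\ q.1 k <= q'.1 k, q'.2 k <= q.2 k & q'.2 k - q'.1 k = (q.2 k - q.1 k) / 2].
(* [f] picks a good subbox with halved sides; its value off good boxes is arbitrary. *)
have [f Hf] : exists f, forall q, good q -> good (f q) /\ step q (f q).
  apply: (choice (fun q q' => good q -> good q' /\ step q q')) => q.
  case: (classic (good q)) => [[gq1 gq2]|]; last by exists q.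
  have [q' [S Hk]] := @sparse_in_halves d a b q.1 q.2 gq1 gq2.
  exists q' => _; split=> //; split=> // k; case: (Hk k) => _ _; move: (gq1 k); lra.
pose q n := iter n f (lo, hi).
have gq n : good (q n).
  elim: n => [|n IH]; last by case: (Hf _ IH).
  by split=> //= k; move: (lt_lohi k); lra.
have sq n : step (q n) (q n.+1) by case: (Hf _ (gq n)).
have nest n m k : (n <= m)%N -> (q n).1 k <= (q m).1 k /\ (q m).2 k <= (q n).2 k.
  elim: m => [|m IH]; first by rewrite leqn0 => /eqP ->; lra.
  rewrite leq_eqVlt ltnS => /orP[/eqP ->|/IH]; first lra.
  by case: (sq m k); lra.
have side n k : (q n).2 k - (q n).1 k = (hi k - lo k) * (/ 2) ^ n.
  elim: n => [|n IH]; first by rewrite /=; lra.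
  by case: (sq n k) => _ _ ->; rewrite IH /=; lra.
have lohi n m k : (q n).1 k <= (q m).2 k.
  have [N1 _] := @nest n (maxn n m) k (leq_maxl _ _).
  have [_ N2] := @nest m (maxn n m) k (leq_maxr _ _).
  by have [G _] := gq (maxn n m); move: (G k); lra.
(* The nested boxes share the point [p], in each coordinate the supremum of the left ends. *)
have /choice [p Hp] : forall k, exists p, forall n, (q n).1 k <= p <= (q n).2 k.
  move=> k.
  have [] := completeness (fun x => exists n, x = (q n).1 k).
  - by exists (hi k) => x [n ->]; apply: (lohi n 0%N).
  - by exists ((q 0%N).1 k); exists 0%N.
  - move=> p [ub lub]; exists p => n; split; first by apply: ub; exists n.
    by apply: lub => x [m ->].
have [n Hn] := cover p (Hp^~ 0%N).
(* The covering box around [p] leaves a margin [r] in every coordinate, so it contains all of [q N]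
   once the sides of [q N] are at most [r]. *)
have [r [r0 Hr]] : exists r, 0 < r /\ forall k, a n k <= p k - r /\ p k + r <= b n k.
  apply: (fin_exists_min_radius (fun k r => a n k <= p k - r /\ p k + r <= b n k)).
    by move=> k r r' ? ?; lra.
  move=> k; exists (Rmin (p k - a n k) (b n k - p k)); move: (Hn k) => [? ?].
  split; first by apply: Rmin_pos; lra.
  by move: (Rmin_l (p k - a n k) (b n k - p k)) (Rmin_r (p k - a n k) (b n k - p k)); lra.
have [N HN] : exists N, forall k, (q N).2 k - (q N).1 k <= r.
  apply: (fin_exists_max_rank (fun k N => (q N).2 k - (q N).1 k <= r)) => [k i j ij|k].
    by have [] := @nest i j k ij; lra.
  have L := lt_lohi k.
  have half1 : Rabs (/ 2) < 1 by rewrite Rabs_pos_eq; lra.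
  have ratio0 : r / (hi k - lo k) > 0 by apply: Rdiv_lt_0_compat; lra.
  have [N HN] := pow_lt_1_zero _ half1 _ ratio0.
  exists N; move: (HN N (le_n N)); rewrite Rabs_pos_eq; last by apply: pow_le; lra.
  rewrite side => H; have: (hi k - lo k) * (/ 2) ^ N < (hi k - lo k) * (r / (hi k - lo k)).
    by apply: Rmult_lt_compat_l; lra.
  have -> : (hi k - lo k) * (r / (hi k - lo k)) = r by field; lra.
  lra.
have [G S] := gq N.
have pos : 0 < box_vol (q N).1 (q N).2.
  apply: box_vol_gt0 => k; suff: 0 < (q N).2 k - (q N).1 k by lra.
  by rewrite side; apply: Rmult_lt_0_compat; [move: (lt_lohi k)|apply: pow_lt]; lra.
have := S n.
have := @le_sum_f_R0 (fun i => box_vol (capl (a i) (q N).1) (capr (b i) (q N).2)) n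
  (fun i => box_vol_ge0 _ _).
(* The trace of the [n]-th box on [q N] is [q N] itself, whose positive volume exceeds the permitted
   half. *)
have -> : box_vol (capl (a n) (q N).1) (capr (b n) (q N).2) = box_vol (q N).1 (q N).2.
  congr box_vol; apply: functional_extensionality => k; rewrite /capl /capr;
  move: (Hp k N) (HN k) (Hr k) => ? ? ?; [rewrite Rmax_right|rewrite Rmin_right] => //; lra.
lra.
Qed.

(** * Open sets: measurable, and not null unless empty *)

Lemma box_vol_fatten {d} (a b : vec d) (eps : R) : 0 < eps ->
  exists r, 0 < r /\
    box_vol (fun k => a k - r) (fun k => b k + r) <= box_vol a b + eps.
Proof.
move=> eps0.
have cont : continuity_pt (fun r => box_vol (fun k => a k - r) (fun k => b k + r)) 0.
  rewrite /box_vol; elim: (index_enum _) => [|k s IH].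
    apply: (continuity_pt_locally_ext (fun _ => 1) _ 1); [lra| |exact: continuity_pt_const].
    by move=> y _; rewrite big_nil.
  apply: (continuity_pt_locally_ext ((fun r => Rmax 0 (b k + r - (a k - r))) *
    (fun r => \big[Rmult/1]_(k <- s) Rmax 0 (b k + r - (a k - r))))%F _ 1); first lra.
    by move=> y _; rewrite big_cons.
  apply: continuity_pt_mult IH.
  (* Writing the maximum of 0 and t as (t + |t|) / 2 gives a form that [reg] handles. *)
  apply: (continuity_pt_locally_ext
    (fun r => (b k - a k + 2 * r + Rabs (b k - a k + 2 * r)) / 2) _ 1); first lra.
    by move=> y _; rewrite /Rmax /Rabs; case: Rle_dec; case: Rcase_abs; lra.
  by reg.
have [r [r0 Hr]] := cont eps eps0.
exists (r / 2); split; first lra.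
have := Hr (r / 2); rewrite /D_x /no_cond /dist /= /Rdist.
have -> : Rabs (r / 2 - 0) = r / 2 by rewrite Rabs_pos_eq; lra.
have r20 : 0 < r / 2 by lra.
have r2r : r / 2 < r by lra.
move=> /(_ (conj (conj I (Rlt_not_eq _ _ r20)) r2r)) /Rabs_def2.
have -> : box_vol (fun k => a k - 0) (fun k => b k + 0) = box_vol a b.
  by congr box_vol; apply: functional_extensionality => k; lra.
lra.
Qed.

(** A cover of total volume at most [V / 8] is fattened so that its open boxes cover; the [n]-th
    gains at most [V / 8 * (/ 2) ^ n.+1]. The total stays below [V / 4], so the open boxes would be
    sparse. *)
Lemma box_not_null {d} (lo hi : vec d) (S : vset d) :
  (forall k, lo k < hi k) -> (forall x, in_box lo hi x -> S x) -> ~ null S.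
Proof.
move=> lt_lohi sub nullS.
pose V := box_vol lo hi; have V0 : 0 < V by apply: box_vol_gt0.
have [|a [b [cover vol]]] := nullS (V / 8); first lra.
have e0 n : 0 < V / 8 * (/ 2) ^ n.+1.
  by apply: Rmult_lt_0_compat; [lra|apply: pow_lt; lra].
have /choice [r Hr] := fun n => @box_vol_fatten d (a n) (b n) _ (e0 n).
apply: (@open_boxes_not_sparse d (fun n k => a n k - r n) (fun n k => b n k + r n) lo hi) => //.
  move=> x /sub /cover [n Hn]; exists n => k.
  by move: (Hn k) (Hr n) => [? ?] [? _]; lra.
move=> N; rewrite -/V.
have geom : forall M, sum_f_R0 (fun n => V / 8 * (/ 2) ^ n.+1) M = V / 8 * (1 - (/ 2) ^ M.+1).
  by elim=> [|M IH]; rewrite ?tech5 ?IH /=; lra.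
have pow0 : 0 < (/ 2) ^ N.+1 by apply: pow_lt; lra.
apply: (@Rle_trans _ (sum_f_R0 (fun n => box_vol (a n) (b n) + V / 8 * (/ 2) ^ n.+1) N)).
  apply: sum_Rle => n _; have [_ Hv] := Hr n; apply: Rle_trans Hv.
  by apply: box_vol_le => k; [apply: Rmax_l|apply: Rmin_l].
by rewrite sum_plus geom; move: (vol N); nra.
Qed.

Lemma open_ball_not_null {d} (x : vec d) (r : R) (S : vset d) :
  0 < r -> (forall y, ball x r y -> S y) -> ~ null S.
Proof.
move=> r0 sub; apply: (box_not_null (fun k => x k - r / 2) (fun k => x k + r / 2)).
  by move=> k; lra.
by move=> y Hy; apply: sub => k; move: (Hy k) => ?; apply: Rabs_def1; lra.
Qed.

(** [S] is its own open superset, and the empty difference is covered by degenerate boxes. These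
    have volume 0 because [0 < d]; in dimension 0 the empty product is 1. *)
Lemma open_measurable {d} (S : vset d) : (0 < d)%N -> vopen S -> measurable S.
Proof.
move=> d0 openS eps eps0; exists S; split=> //; split=> //.
exists (fun _ => vzero), (fun _ => vzero); split; first by move=> x [].
move=> N; rewrite (PartSum.sum_eq _ (fun _ => 0)) ?sum_cte; first by lra.
move=> n _; rewrite (box_volD1 (Ordinal d0)) Rmax_left ?Rmult_0_l //.
by rewrite /vzero; lra.
Qed.

(** * Topology of R^d *)

Definition vclosed {d} (S : vset d) : Prop := forall x, closure S x -> S x.

Lemma ball_le {d} (x y : vec d) (r r' : R) : r <= r' -> ball x r y -> ball x r' y.
Proof. by move=> rr' H k; move: (H k); lra. Qed.

Lemma ball_open {d} (x : vec d) (r : R) : vopen (ball x r).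
Proof.
move=> y Hy.
have [e [e0 He]] : exists e, 0 < e /\ forall k, Rabs (y k - x k) + e <= r.
  apply: (fin_exists_min_radius (fun k e => Rabs (y k - x k) + e <= r)).
    by move=> k e e'; lra.
  by move=> k; exists (r - Rabs (y k - x k)); move: (Hy k); lra.
exists e; split=> // z Hz k.
have -> : z k - x k = (z k - y k) + (y k - x k) by ring.
by move: (Rabs_triang (z k - y k) (y k - x k)) (Hz k) (He k); lra.
Qed.

Lemma not_closure_ball {d} (S : vset d) (x : vec d) :
  ~ closure S x -> exists r, 0 < r /\ forall y, ball x r y -> ~ S y.
Proof.
move=> nx; have [r nr] := not_all_ex_not _ _ nx.
have [r0 H] := imply_to_and _ _ nr.
by exists r; split=> // y xy Sy; apply: H; exists y.
Qed.

Lemma closure_closed {d} (S : vset d) : vclosed (closure S).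
Proof.
move=> x Hx r r0.
have [y [xy Hy]] := Hx r r0.
have [e [e0 He]] := ball_open x r y xy.
by have [z [yz Sz]] := Hy e e0; exists z; split=> //; apply: He.
Qed.

Lemma closure_sub {d} (S T : vset d) :
  (forall x, S x -> T x) -> forall x, closure S x -> closure T x.
Proof. by move=> ST x H r /H [y [xy /ST]]; exists y. Qed.

Lemma region_closed {d} (S : vset d) : region S -> vclosed S.
Proof.
move=> [_ ES] x Hx; apply/ES/closure_closed.
by apply: closure_sub Hx => y /ES.
Qed.

Lemma vec_bounded {d} (x : vec d) : exists n, forall k, Rabs (x k) < INR n.
Proof.
apply: (fin_exists_max_rank (fun k n => Rabs (x k) < INR n)); last first.
  by move=> k; apply: exists_INR_gt.
by move=> k n m /leP /le_INR; lra.
Qed.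

Lemma compact_bounded {d} (S : vset d) :
  compact S -> exists B, forall x, S x -> forall k, Rabs (x k) <= B.
Proof.
move=> cS; have [||s Hs] := cS nat (fun n => ball vzero (INR n)).
- by move=> n; apply: ball_open.
- move=> x _; have [n Hn] := vec_bounded x; exists n => k.
  by rewrite Rminus_0_r.
have [N HN] := list_exists_max_rank leq s (fun i n n' nn' H => leq_trans H nn')
  (fun i _ => ex_intro _ i (leqnn i)).
exists (INR N) => x /Hs [n [/HN /leP /le_INR ? Hx]] k.
by move: (Hx k); rewrite Rminus_0_r; lra.
Qed.

(** * Lattices *)

Lemma in_latticeD {d n} (w : 'I_n -> vec d) (x y : vec d) :
  in_lattice w x -> in_lattice w y -> in_lattice w (vadd x y).
Proof.
move=> [c ->] [c' ->]; exists (fun i => (c i + c' i)%Z).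
apply: functional_extensionality => k; rewrite /vadd /vsum -big_split.
by apply: eq_bigr => i _ /=; rewrite plus_IZR; ring.
Qed.

Lemma in_latticeN {d n} (w : 'I_n -> vec d) (x : vec d) :
  in_lattice w x -> in_lattice w (fun k => - x k).
Proof.
move=> [c ->]; exists (fun i => (- c i)%Z).
apply: functional_extensionality => k; rewrite /vsum.
rewrite (big_morph Ropp Ropp_plus_distr Ropp_0).
by apply: eq_bigr => i _ /=; rewrite opp_IZR; ring.
Qed.

Lemma in_lattice0 {d n} (w : 'I_n -> vec d) : in_lattice w vzero.
Proof.
exists (fun _ => 0%Z); apply: functional_extensionality => k.
by rewrite /vsum big1 // => i _; rewrite Rmult_0_l.
Qed.

Lemma in_lattice_gen {d n} (w : 'I_n -> vec d) (i : 'I_n) : in_lattice w (w i).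
Proof.
exists (fun j => if j == i then 1%Z else 0%Z).
apply: functional_extensionality => k; rewrite /vsum (bigD1 i) //= eqxx big1.
  by ring.
by move=> j /negbTE ->; ring.
Qed.

(** Every branch is thus the translation by [v ord0] modulo the lattice. *)
Lemma in_lattice_diffs {d} (v : 'I_d.+1 -> vec d) (i : 'I_d.+1) :
  in_lattice (diffs v) (vsub (v i) (v ord0)).
Proof.
case: (unliftP ord0 i) => [j ->|->]; first exact: in_lattice_gen.
have -> : vsub (v ord0) (v ord0) = vzero; last exact: in_lattice0.
by apply: functional_extensionality => k; rewrite /vsub /vzero; ring.
Qed.

Lemma Rabs_big_le {I : finType} (f g : I -> R) :
  (forall i, Rabs (f i) <= g i) ->
  Rabs (\big[Rplus/0]_i f i) <= \big[Rplus/0]_i g i.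
Proof.
move=> H; apply: (big_ind2 (fun x y => Rabs x <= y)) => //.
  by rewrite Rabs_R0; lra.
by move=> x1 x2 y1 y2; move: (Rabs_triang x1 y1); lra.
Qed.

(** The matrix [W] with rows [w i] is invertible, so the coefficients are recovered from the vector
    by [invmx W]; the absolute column sums of the inverse, times [B], bound them. *)
Lemma lin_indep_coef_bound {d} (w : 'I_d -> vec d) (B : R) :
  lin_indep w ->
  exists M : nat, forall c : 'I_d -> R,
    (forall k, Rabs (vsum (fun i k => c i * w i k) k) <= B) ->
    forall i, Rabs (c i) <= INR M.
Proof.
move=> indep; pose W : 'M[R]_d := (\matrix_(i, k) w i k)%R.
have rowE (c : 'rV[R]_d) k : (c *m W)%R ord0 k = vsum (fun i k => c ord0 i * w i k) k.
  by rewrite mxE; apply: eq_bigr => i _; rewrite mxE.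
have unitW : (W \in unitmx)%R.
  rewrite -row_free_unit; apply: inj_row_free => c cW0.
  apply/matrixP => i j; rewrite ord1 mxE; apply: (indep (fun j => c ord0 j)).
  by apply: functional_extensionality => k; rewrite -rowE cW0 mxE.
have [M HM] : exists M, forall i, \big[Rplus/0]_(k < d) (B * Rabs (invmx W k i)) <= INR M.
  apply: (fin_exists_max_rank
    (fun i M => \big[Rplus/0]_(k < d) (B * Rabs (invmx W k i)) <= INR M)).
    by move=> i n n' /leP /le_INR; lra.
  move=> i; have [n Hn] := exists_INR_gt (\big[Rplus/0]_(k < d) (B * Rabs (invmx W k i))).
  by exists n; lra.
exists M => c Hc i; apply: Rle_trans (HM i).
pose u : 'rV[R]_d := (\row_j c j)%R.
have -> : c i = \big[Rplus/0]_(k < d) ((u *m W)%R ord0 k * invmx W k i).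
  have : ((u *m W *m invmx W) ord0 i = c i)%R by rewrite mulmxK // mxE.
  by rewrite mxE => <-.
apply: Rabs_big_le => k; rewrite Rabs_mult.
apply: Rmult_le_compat_r; first exact: Rabs_pos.
move: (Hc k); rewrite rowE; congr (Rabs _ <= _).
by apply: eq_bigr => j _; rewrite mxE.
Qed.

Lemma lattice_bounded_finite {d} (w : 'I_d -> vec d) (B : R) :
  lin_indep w ->
  exists s : list (vec d), forall l,
    in_lattice w l -> (forall k, Rabs (l k) <= B) -> List.In l s.
Proof.
move=> indep; have [M HM] := lin_indep_coef_bound w B indep.
(* The ordinal [f i] encodes the coefficient [f i - M], which ranges from [-M] to [M]. *)
pose point (f : {ffun 'I_d -> 'I_(M + M).+1}) : vec d :=
  vsum (fun i k => IZR (Z.of_nat (f i) - Z.of_nat M) * w i k).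
exists (List.map point (enum {ffun 'I_d -> 'I_(M + M).+1})) => _ [c ->] bnd.
have cM i : (- Z.of_nat M <= c i <= Z.of_nat M)%Z.
  have := HM _ bnd i; rewrite INR_IZR_INZ -abs_IZR => /le_IZR; lia.
pose f := [ffun i => inord (Z.to_nat (c i + Z.of_nat M))] : {ffun 'I_d -> 'I_(M + M).+1}.
suff -> : vsum (fun i k => IZR (c i) * w i k) = point f by apply/List.in_map/In_enum.
apply: functional_extensionality => k; apply: eq_bigr => i _.
congr (IZR _ * _); rewrite ffunE inordK; first by move: (cM i); lia.
rewrite ltnS; apply/leP; rewrite -plusE; move: (cM i); lia.
Qed.

(* Choose the stage and the base point so that the number of [L]-translates of
   the point in the set is least: it cannot drop at later stages, nor, by
   closedness, grow at nearby points. *)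
Lemma fiber_stabilizes {d} (L : vset d) (S : nat -> vset d) (B : R) :
  (forall C, exists s : list (vec d), forall l,
    L l -> (forall k, Rabs (l k) <= C) -> List.In l s) ->
  (forall n, vclosed (S n)) ->
  (forall n m x, (n <= m)%N -> S m x -> S n x) ->
  (forall x, S 0%N x -> forall k, Rabs (x k) <= B) ->
  exists n x0 r, 0 < r /\ forall x, ball x0 r x -> forall l, L l ->
    S n (vadd x l) -> forall m, S m (vadd x l).
Proof.
move=> finL closedS decS bndS.
pose covers n x s := forall l, L l -> S n (vadd x l) -> List.In l s.
pose has k := exists n x s, List.length s = k /\ covers n x s.
have lbound x C n l : (forall k, Rabs (x k) <= C) -> S n (vadd x l) ->
    forall k, Rabs (l k) <= B + C.
  move=> xC /(decS _ _ _ (leq0n n)) /bndS H k.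
  have -> : l k = vadd x l k + - x k by rewrite /vadd; ring.
  by move: (Rabs_triang (vadd x l k) (- x k)) (H k) (xC k); rewrite Rabs_Ropp; lra.
have [k [[[n [x0 [s [Es cov]]]] kmin] _]] : has_unique_least_element le has.
  apply: dec_inh_nat_subset_has_unique_least_element.
    by move=> k; apply: classic.
  have [s Hs] := finL (B + 0); exists (List.length s), 0%N, vzero, s; split=> // l Ll Sl.
  by apply: Hs (lbound _ _ _ _ _ Sl) => // k; rewrite Rabs_R0; lra.
have [C HC] := vec_bounded x0.
(* [s0] holds every lattice vector that can carry a point within distance 1 of [x0] into the bounded
   set [S 0]. Each of them is in [s] or sends a whole ball around [x0] off the closed set [S n]. *)
have [s0 Hs0] := finL (B + (INR C + 1)).
have [r [r0 Hr]] : exists r, 0 < r /\ forall l, List.In l s0 ->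
    L l -> List.In l s \/ forall y, ball (vadd x0 l) r y -> ~ S n y.
  apply: (list_exists_min_radius (fun l r =>
    L l -> List.In l s \/ forall y, ball (vadd x0 l) r y -> ~ S n y)).
    move=> l r r' rr' H /H [|{}H]; [by left|right => y Hy].
    by apply: H; apply: ball_le Hy.
  move=> l _; case: (classic (S n (vadd x0 l))) => Sl.
    by exists 1; split; [lra|move=> Ll; left; apply: cov].
  have [|r [r0 Hr]] := @not_closure_ball d (S n) (vadd x0 l).
    by move=> /closedS.
  by exists r; split=> // _; right.
exists n, x0, (Rmin r 1); split; first by apply: Rmin_pos; lra.
move=> x Hx.
have xC k0 : Rabs (x k0) <= INR C + 1.
  have -> : x k0 = (x k0 - x0 k0) + x0 k0 by ring.
  move: (Rabs_triang (x k0 - x0 k0) (x0 k0)) (Hx k0) (HC k0) (Rmin_r r 1); lra.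
(* No new lattice vector enters the fibre near [x0], so [s] still covers it. *)
have covx : covers n x s.
  move=> l Ll Sl.
  case: (Hr l (Hs0 l Ll (lbound _ _ _ _ xC Sl)) Ll) => // /(_ (vadd x l)) [] //.
  move=> j; rewrite /vadd; have -> : x j + l j - (x0 j + l j) = x j - x0 j by ring.
  by move: (Hx j) (Rmin_l r 1); lra.
move=> l Ll Sl m; case: (leqP m n) => [mn|/ltnW nm]; first exact: decS mn Sl.
apply: NNPP => nSl.
(* If [l] left the fibre at the later stage [m], deleting it from [s] would give a shorter covering
   list. *)
have [s1 [s2 Es12]] := List.in_split _ _ (covx l Ll Sl).
have /kmin : has (List.length (s1 ++ s2)%list).
  exists m, x, (s1 ++ s2)%list; split=> // l' Ll' Sl'.
  have := covx l' Ll' (decS _ _ _ nm Sl'); rewrite Es12 => H.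
  by case: (List.in_elt_inv _ _ _ _ H) => // E; case: nSl; rewrite -E.
by rewrite -Es Es12 !List.length_app /=; lia.
Qed.

(** * The rotation *)

(** For [l] in the lattice these points form the group L + Z v_0; negative [j] are included to make
    its neighbourhoods invariant in both directions. *)
Definition orbit_point {d} (v : 'I_d.+1 -> vec d) (j : Z) (l : vec d) : vec d :=
  fun k => IZR j * v ord0 k + l k.

(** If the [r]-ball at [z] missed the group, the open invariant [r / 2]-neighbourhood of the group
    would contain a ball at 0 and miss one at [z]; neither it nor its complement would be null. *)
Lemma ergodic_orbit_dense {d} (v : 'I_d.+1 -> vec d) :
  (0 < d)%N -> rotation_ergodic v -> forall z r, 0 < r ->
  exists j l, in_lattice (diffs v) l /\ ball z r (orbit_point v j l).
Proof.
move=> d0 erg z r r0; apply: NNPP => far.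
pose E (x : vec d) := exists j l, in_lattice (diffs v) l /\ ball (orbit_point v j l) (r / 2) x.
have inv x j l y : in_lattice (diffs v) l -> (forall k, y k = x k + orbit_point v j l k) ->
    E x -> E y.
  move=> Ll Ey [j' [l' [Ll' H]]]; exists (j' + j)%Z, (vadd l' l); split.
    exact: in_latticeD.
  move=> k; rewrite Ey; have := H k; rewrite /orbit_point /vadd plus_IZR.
  congr (Rabs _ < _); ring.
have openE : vopen E.
  move=> x [j [l [Ll /ball_open [e [e0 He]]]]].
  by exists e; split=> // y /He; exists j, l.
case: (erg E).
- exact: open_measurable.
- move=> x l Ll; split.
    by apply: (inv _ 0%Z l) => // k; rewrite /orbit_point /vadd; ring.
  apply: (inv _ 0%Z _ _ (in_latticeN _ _ Ll)) => k.
  by rewrite /orbit_point /vadd; ring.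
- move=> x; split.
    by apply: (inv _ 1%Z _ _ (in_lattice0 _)) => k; rewrite /orbit_point /vadd /vzero; ring.
  by apply: (inv _ (-1)%Z _ _ (in_lattice0 _)) => k; rewrite /orbit_point /vadd /vzero; ring.
- apply: (open_ball_not_null vzero (r / 2)); first lra.
  move=> y Hy; exists 0%Z, vzero; split; first exact: in_lattice0.
  move=> k; move: (Hy k); rewrite /orbit_point; congr (Rabs _ < _); rewrite /vzero; ring.
- apply: (open_ball_not_null z (r / 2)); first lra.
  move=> y Hy [j [l [Ll Hl]]]; apply: far; exists j, l; split=> // k.
  have -> : orbit_point v j l k - z k = - (y k - orbit_point v j l k) + (y k - z k) by ring.
  move: (Rabs_triang (- (y k - orbit_point v j l k)) (y k - z k)) (Hy k) (Hl k).
  by rewrite Rabs_Ropp; lra.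
Qed.

(** * The stages [Omega_n] *)

(** There are finitely many branches: if no [vsub y (v i)] were in the closure of [S], a common
    radius would keep the image of [S] away from [y]. *)
Lemma closure_image_branch {d m} (v : 'I_m -> vec d) (ix : vec d -> 'I_m) (S : vset d) y :
  closure (image (pt_map v ix) S) y -> exists i, closure S (vsub y (v i)).
Proof.
move=> Hy; apply: NNPP => /not_ex_all_not H.
have [r [r0 Hr]] := fin_exists_min_radius
  (fun i r => forall z, ball (vsub y (v i)) r z -> ~ S z)
  (fun i r r' rr' G z Hz => G z (ball_le _ _ _ _ rr' Hz))
  (fun i => not_closure_ball _ _ (H i)).
have [z [Hx [x [Sx E]]]] := Hy r r0; rewrite {}E in Hx.
apply: (Hr (ix x) x _ Sx) => k; move: (Hx k); rewrite /pt_map /vadd /vsub.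
by congr (Rabs _ < _); ring.
Qed.

Lemma Omega_n_closed {d m} (Om : vset d) (v : 'I_m -> vec d) ix n :
  vclosed Om -> vclosed (Omega_n Om v ix n).
Proof. by case: n => // n _; apply: closure_closed. Qed.

Lemma Omega_n_decr {d m} (Om : vset d) (v : 'I_m -> vec d) ix :
  vclosed Om -> (forall x, Om x -> Om (pt_map v ix x)) ->
  forall n n' x, (n <= n')%N -> Omega_n Om v ix n' x -> Omega_n Om v ix n x.
Proof.
move=> closedOm stab.
have step n x : Omega_n Om v ix n.+1 x -> Omega_n Om v ix n x.
  elim: n x => [|n IH] x.
    by move=> H; apply: closedOm; apply: closure_sub H => _ [y [/stab Hy ->]].
  by apply: closure_sub => _ [y [/IH Hy ->]]; exists y.
move=> n n' x; elim: n' => [|n' IH]; first by rewrite leqn0 => /eqP ->.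
by rewrite leq_eqVlt ltnS => /orP[/eqP -> //|nn' /step]; apply: IH.
Qed.

Lemma attractor_closed {d m} (Om : vset d) (v : 'I_m -> vec d) ix :
  vclosed Om -> vclosed (attractor Om v ix).
Proof.
move=> closedOm x Hx n; apply: Omega_n_closed => //.
by apply: closure_sub Hx => y.
Qed.

(** A point of every stage has its image in every next stage; stage 0 needs F(Omega) to lie in
    Omega. *)
Lemma attractor_stable {d m} (Om : vset d) (v : 'I_m -> vec d) ix :
  (forall x, Om x -> Om (pt_map v ix x)) ->
  forall x, attractor Om v ix x -> attractor Om v ix (pt_map v ix x).
Proof.
move=> stab x Ax [|n]; first exact: stab (Ax 0%N).
move=> r r0; exists (pt_map v ix x); split; last by exists x.
by move=> k; rewrite Rminus_diag_eq // Rabs_R0.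
Qed.

(** * Translates of a ball along the rotation *)

(** The set [ball x0 r] + L + j v_0: the lift to R^d of the projected ball rotated [j] times. *)
Definition tube {d} (v : 'I_d.+1 -> vec d) (x0 : vec d) (r : R) (j : Z) : vset d :=
  fun y => exists l, in_lattice (diffs v) l /\ ball x0 r (vsub y (orbit_point v j l)).

Lemma tube_open {d} (v : 'I_d.+1 -> vec d) x0 r j : vopen (tube v x0 r j).
Proof.
move=> y [l [Ll /ball_open [e [e0 He]]]]; exists e; split=> // z Hz.
exists l; split=> //; apply: He => k; move: (Hz k); rewrite /vsub.
by congr (Rabs _ < _); ring.
Qed.

(** All [v i] agree modulo the lattice, so every branch raises the tube index by exactly one. *)
Lemma tube_branch {d} (v : 'I_d.+1 -> vec d) x0 r j i y :
  tube v x0 r (j + 1) (vadd y (v i)) <-> tube v x0 r j y.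
Proof.
split=> -[l [Ll H]].
- exists (fun k => l k - vsub (v i) (v ord0) k); split.
    by apply: in_latticeD => //; apply/in_latticeN/in_lattice_diffs.
  move=> k; move: (H k); rewrite /vsub /vadd /orbit_point plus_IZR.
  by congr (Rabs _ < _); ring.
- exists (vadd l (vsub (v i) (v ord0))); split.
    by apply: in_latticeD => //; apply: in_lattice_diffs.
  move=> k; move: (H k); rewrite /vsub /vadd /orbit_point plus_IZR.
  by congr (Rabs _ < _); ring.
Qed.

Lemma vsubK {d} (x y : vec d) : vadd (vsub x y) y = x.
Proof. by apply: functional_extensionality => k; rewrite /vadd /vsub; ring. Qed.

Theorem theorem2p1 (d : nat) (Om : vset d) (P : 'I_d.+1 -> vset d)
    (v : 'I_d.+1 -> vec d) (ix : vec d -> 'I_d.+1) :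
  (0 < d)%N ->
  piecewise_translation Om P v ix ->
  lin_indep (diffs v) ->
  rotation_ergodic v ->
  exists n : nat,
    set_eq (Omega_n Om v ix n) (Omega_n Om v ix n.+1) /\
    (forall k : nat, (n <= k)%N -> set_eq (Omega_n Om v ix k) (attractor Om v ix)).
Proof.
move=> d0 [regOm [_ [_ [_ [_ [transP [ixP _]]]]]]] indep erg.
have closedOm := region_closed _ regOm.
have stab x : Om x -> Om (pt_map v ix x) by move=> /ixP /transP.
have decr := Omega_n_decr Om v ix closedOm stab.
pose A := attractor Om v ix.
have closedA := attractor_closed Om v ix closedOm.
have [B HB] := compact_bounded _ (proj1 regOm).
have [n [x0 [r [r0 Hr]]]] := fiber_stabilizes (in_lattice (diffs v)) (Omega_n Om v ix) B
  (fun C => lattice_bounded_finite _ C indep)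
  (fun i => Omega_n_closed Om v ix i closedOm) decr HB.
(* The base case is the choice of [n], [x0] and [r]. In the step [y] is a limit of points F(x),
   which enter the open tube; then x lies in the previous tube, hence in [A], and [A] is stable and
   closed. *)
have tubeA j y : Omega_n Om v ix (n + j) y -> tube v x0 r (Z.of_nat j) y -> A y.
  elim: j y => [|j IH] y.
    rewrite addn0 => Oy [l [Ll Hy]].
    have Ey : vadd (vsub y (orbit_point v 0 l)) l = y.
      by apply: functional_extensionality => k; rewrite /vadd /vsub /orbit_point; ring.
    by move=> m; rewrite -Ey; apply: Hr; rewrite ?Ey.
  rewrite addnS => Oy Ty; apply: closedA => e e0.
  have [e' [e'0 He']] := tube_open v x0 r _ y Ty.
  have [z [Hx [x [Ox E]]]] := Oy (Rmin e e') (Rmin_pos _ _ e0 e'0); rewrite {}E in Hx.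
  exists (pt_map v ix x); split; first exact: ball_le (Rmin_l _ _) Hx.
  apply: attractor_stable => //; apply: IH => //.
  have := He' _ (ball_le _ _ _ _ (Rmin_r _ _) Hx).
  by rewrite Nat2Z.inj_succ -Z.add_1_r => /tube_branch.
(* By density the tubes cover [Om]; compactness bounds the indices needed, though some may be
   negative. *)
have [J HJ] : exists J, forall y, Om y ->
    exists j, (- Z.of_nat J <= j <= Z.of_nat J)%Z /\ tube v x0 r j y.
  have [|y _|s Hs] := proj1 regOm Z (tube v x0 r).
  - exact: tube_open.
  - have [j [l [Ll H]]] := ergodic_orbit_dense v d0 erg (vsub y x0) r r0.
    exists j, l; split=> // k; move: (H k); rewrite -Rabs_Ropp /vsub.
    by congr (Rabs _ < _); ring.
  have [J HJ] := list_exists_max_rank (fun j N => (- Z.of_nat N <= j <= Z.of_nat N)%Z) s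
    ltac:(move=> j N N' /leP; lia) ltac:(move=> j _; exists (Z.to_nat (Z.abs j)); lia).
  by exists J => y /Hs [j [js Ty]]; exists j; split=> //; apply: HJ.
(* Going back through [i] branches leads to a point of [Om], with tube index between [-J] and [J];
   each branch adds one to the index. *)
have shift i y : Omega_n Om v ix i y ->
    exists j, (- Z.of_nat J <= j <= Z.of_nat J)%Z /\ tube v x0 r (j + Z.of_nat i) y.
  elim: i y => [|i IH] y.
    by move=> /HJ [j [? ?]]; exists j; rewrite Z.add_0_r.
  move=> /closure_image_branch [b /(Omega_n_closed _ _ _ _ closedOm) /IH [j [Hj Tj]]].
  exists j; split=> //; rewrite Nat2Z.inj_succ -Z.add_1_r Z.add_assoc.
  by rewrite -(vsubK y (v b)); apply/tube_branch.
(* At [i = J] the index [j + J] lies between 0 and [J + J], so [tubeA] applies, and stage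
   [n + (J + J)] lies inside every stage it may require. *)
have final k : (n + (J + J) <= k)%N -> set_eq (Omega_n Om v ix k) A.
  move=> nk y; split; last exact.
  move=> /(decr _ _ _ nk) Oy.
  have JnJ : (J <= n + (J + J))%N by rewrite addnA leq_addl.
  have [j [Hj Tj]] := shift _ _ (decr _ _ _ JnJ Oy).
  apply: (tubeA (Z.to_nat (j + Z.of_nat J))); last by rewrite Z2Nat.id //; lia.
  by apply: decr Oy; rewrite leq_add2l; apply/leP; rewrite -plusE; lia.
exists (n + (J + J))%N; split=> // x.
by rewrite (final _ (leqnn _) x) (final _ (leqnSn _) x).
Qed.
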